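(* For every undirected bipartite graph $G = (U,V;E)$, every function $\omega \colon U \to \mathbb{Z}_+$, and every positive integer $k$, we have $$\tau({\bf M}_G, \omega, k) \le k,$$ where ${\bf M}_G$ is the transversal matroid on $U$ defined by $G$.
   Context: $\mathbb{Z}_+$ is the set of non-negative integers; $[z]=\{1,\dots,z\}$ for a positive integer $z$, and $[0]=\emptyset$. For $\rho\colon X\to\mathbb{Z}_+$ with $X$ finite and $Y\subseteq X$, $\rho(Y)=\sum_{x\in Y}\rho(x)$. All graphs are finite and simple. $G=(U,V;E)$ denotes a bipartite graph whose vertex set is partitioned into $U$ and $V$, each edge consisting of one vertex of $U$ and one of $V$. A matching is a set of pairwise disjoint edges; for $F\subseteq E$, $\partial(F)$ is the set of vertices contained in some edge of $F$. A matroid is a pair ${\bf M}=(U,\mathcal{I})$ with $U$ a finite set and $\mathcal{I}$ a non-empty family of subsets of $U$ (the independent sets) closed under taking subsets and such that if $I,J\in\mathcal{I}$ and $|I|<|J|$ then $I\cup\{u\}\in\mathcal{I}$ for some $u\in J\setminus I$. A base is an element of $\mathcal{I}$ of maximum cardinality. A base $B$ of ${\bf M}$ is an optimal base with respect to $\omega\colon U\to\mathbb{Z}_+$ if $\omega(B)\ge\omega(B')$ for every base $B'$ of ${\bf M}$. The transversal matroid ${\bf M}_G=(U,\mathcal{I}_G)$: $I\in\mathcal{I}_G$ if and only if there is a matching $M$ in $G$ with $I=\partial(M)\cap U$. For a positive integer $\ell$, ${\bf M}^\ell=(U,\mathcal{I}^\ell)$ is the matroid in which $I\in\mathcal{I}^\ell$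 if and only if there are pairwise disjoint (possibly empty) subsets $I_1,\dots,I_\ell\subseteq I$ with $I_1\cup\dots\cup I_\ell=I$ and $I_i\in\mathcal{I}$ for all $i\in[\ell]$. For a matroid ${\bf M}=(U,\mathcal{I})$, $\omega\colon U\to\mathbb{Z}_+$ and a positive integer $k$, a subset $X\subseteq U$ is a $k$-robust subset of ${\bf M}$ with respect to $\omega$ if for every base $B$ of ${\bf M}$ there exist pairwise disjoint subsets $X_1,\dots,X_{|B\setminus X|}\subseteq X\setminus B$ and a bijection $\phi\colon B\setminus X\to[|B\setminus X|]$ such that: (R1) $|X_i|=k$ for every $i\in[|B\setminus X|]$; (R2) $\omega(u)\le\omega(v)$ for every $u\in B\setminus X$ and every $v\in X_{\phi(u)}$; (R3) for every $(u_1,\dots,u_{|B\setminus X|})\in X_1\times\dots\times X_{|B\setminus X|}$, we have $(B\cap X)\cup\{u_1,\dots,u_{|B\setminus X|}\}\in\mathcal{I}$. $\tau({\bf M},\omega,k)$ is the minimum positive integer $\ell$ such that every optimal base of ${\bf M}^\ell$ with respect to $\omega$ is a $k$-robust subset of ${\bf M}$ with respect to $\omega$. *)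

(* Defs.v *)
From mathcomp Require Import all_boot.
From mathcomp Require Import boolp.

Set Implicit Arguments.
Unset Strict Implicit.
Unset Printing Implicit Defensive.

Record matroid (U : finType) := Matroid {
  indep : {set {set U}};
  indep_neq0 : indep != set0;
  indep_sub : forall I J : {set U}, J \in indep -> I \subset J -> I \in indep;
  indep_aug : forall I J : {set U}, I \in indep -> J \in indep ->
    #|I| < #|J| -> exists2 u, u \in J :\: I & u |: I \in indep
}.

Definition weight (U : finType) (w : U -> nat) (Y : {set U}) : nat :=
  \sum_(x in Y) w x.

Definition base (U : finType) (M : matroid U) (B : {set U}) : bool :=
  (B \in indep M) && [forall I in indep M, #|I| <= #|B|].

Definition optimal_base (U : finType) (M : matroid U) (w : U -> nat)
    (B : {set U}) : bool :=
  base M B && [forall B' : {set U}, base M B' ==> (weight w B' <= weight w B)].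

Definition pairwise_disjoint (U : finType) (m : nat) (Xs : 'I_m -> {set U}) :=
  [forall i : 'I_m, forall j : 'I_m, (i != j) ==> [disjoint Xs i & Xs j]].

(* A bipartite graph (U, V; E) is given by its two colour classes, as finite
   types, and its edge set E : {set U * V}. *)
Definition matching (U V : finType) (E F : {set U * V}) : bool :=
  (F \subset E) &&
  [forall e in F, forall f in F, (e != f) ==> (e.1 != f.1) && (e.2 != f.2)].

(* The set of vertices of U covered by F, that is, the trace on U of the set of
   all vertices contained in an edge of F. *)
Definition coveredU (U V : finType) (F : {set U * V}) : {set U} :=
  [set e.1 | e in F].

Definition transversal_indep (U V : finType) (E : {set U * V}) :
    {set {set U}} :=
  [set I : {set U} |
    [exists F : {set U * V}, matching E F && (I == coveredU F)]].

Section Transversal.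
Variables (U V : finType) (E : {set U * V}).
Implicit Types (F N : {set U * V}) (I J : {set U}).

Lemma matchingP F :
  reflect [/\ F \subset E,
              {in F &, injective (@fst U V)} & {in F &, injective (@snd U V)}]
          (matching E F).
Proof.
apply: (iffP andP) => [[sFE /forall_inP H]|[sFE i1 i2]]; split=> //.
- move=> e f eF fF ef; apply/eqP/negPn/negP => ne.
  by move: (H e eF) => /forall_inP/(_ f fF); rewrite ne ef eqxx.
- move=> e f eF fF ef; apply/eqP/negPn/negP => ne.
  by move: (H e eF) => /forall_inP/(_ f fF); rewrite ne ef eqxx andbF.
- apply/forall_inP=> e eF; apply/forall_inP=> f fF; apply/implyP=> ne.
  by apply/andP; split; apply: contra ne => /eqP h; apply/eqP; [apply: i1|apply: i2].
Qed.

Lemma transversal_indepP I :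
  reflect (exists2 F, matching E F & I = coveredU F)
          (I \in transversal_indep E).
Proof.
rewrite inE; apply: (iffP existsP) => [[F /andP[mF /eqP ->]]|[F mF ->]].
  by exists F.
by exists F; rewrite mF eqxx.
Qed.

Lemma matching_sub F N : matching E N -> F \subset N -> matching E F.
Proof.
case/matchingP=> sNE i1 i2 /[dup] sFN /subsetP h; apply/matchingP; split.
- exact: subset_trans sNE.
- by move=> e f /h eN /h fN; apply: i1.
- by move=> e f /h eN /h fN; apply: i2.
Qed.

Lemma transversal_neq0 : transversal_indep E != set0.
Proof.
apply/set0Pn; exists set0; apply/transversal_indepP; exists set0.
  by apply/matchingP; split; rewrite ?sub0set // => e f; rewrite inE.
by rewrite /coveredU imset0.
Qed.

Lemma transversal_sub I J :
  J \in transversal_indep E -> I \subset J -> I \in transversal_indep E.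
Proof.
case/transversal_indepP=> F mF -> sI.
apply/transversal_indepP; exists [set e in F | e.1 \in I].
  by apply: (matching_sub mF); apply/subsetP=> e; rewrite inE => /andP[].
apply/setP=> x; apply/idP/imsetP=> [xI|[e]]; last first.
  by rewrite inE => /andP[_ ?] ->.
have /imsetP[e eF xe] := subsetP sI x xI.
by exists e; rewrite // inE eF -xe.
Qed.

Lemma matching_add F u v : matching E F -> (u, v) \in E ->
  u \notin coveredU F -> v \notin [set e.2 | e in F] ->
  matching E ((u, v) |: F).
Proof.
move=> /matchingP[sFE i1 i2] uvE uF vF; apply/matchingP; split.
- by rewrite subUset sub1set uvE.
- move=> e f /setU1P[->|eF] /setU1P[->|fF] //= h; last exact: i1.
  + by case/imsetP: uF; exists f.
  + by case/imsetP: uF; exists e.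
- move=> e f /setU1P[->|eF] /setU1P[->|fF] //= h; last exact: i2.
  + by case/imsetP: vF; exists f.
  + by case/imsetP: vF; exists e.
Qed.

Lemma transversal_aug I J :
  I \in transversal_indep E -> J \in transversal_indep E -> #|I| < #|J| ->
  exists2 u, u \in J :\: I & u |: I \in transversal_indep E.
Proof.
case/transversal_indepP=> F0 mF0 I0 /transversal_indepP[N mN ->] ltIJ.
pose P F := matching E F && (I == coveredU F).
have PF0 : P F0 by rewrite /P mF0 I0 eqxx.
case: (arg_maxnP (fun F => #|F :&: N|) PF0) => F /andP[mF /eqP IF] maxF.
have /matchingP[sFE iF1 iF2] := mF; have /matchingP[sNE iN1 iN2] := mN.
have ltV : #|[set e.2 | e in F]| < #|[set e.2 | e in N]|.
  move: ltIJ; rewrite IF /coveredU.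
  by rewrite !card_in_imset.
have [v vN vF] : exists2 v, v \in [set e.2 | e in N] & v \notin [set e.2 | e in F].
  have /subsetPn[v vN vF] : ~~ ([set e.2 | e in N] \subset [set e.2 | e in F]).
    by apply: contraTN ltV => /subset_leq_card; rewrite -leqNgt.
  by exists v.
case/imsetP: vN => -[u v'] uvN /= vv'; subst v'.
have uvE := subsetP sNE _ uvN.
have uJ : u \in coveredU N by apply/imsetP; exists (u, v).
have [uI|uI] := boolP (u \in I); last first.
  exists u; first by rewrite inE uI.
  apply/transversal_indepP; exists ((u, v) |: F).
    by apply: matching_add; rewrite -?IF.
  by rewrite /coveredU imsetU1 IF.
have /imsetP[e eF ue] : u \in coveredU F by rewrite -IF.
have eN : e \notin N.
  apply: contra vF => eN; apply/imsetP; exists e => //.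
  by rewrite -(iN1 _ _ uvN eN).
pose F' := (u, v) |: (F :\ e).
have mF' : matching E F'.
  apply: matching_add => //.
  - exact: matching_sub (subD1set F e).
  - apply/imsetP => -[f /setD1P[nfe fF] uf].
    by case/eqP: nfe; apply: iF1; rewrite // -uf -ue.
  - apply: contra vF => /imsetP[f /setD1P[_ fF] ->].
    by apply/imsetP; exists f.
have cF' : I == coveredU F'.
  rewrite IF /coveredU -{1}(setD1K eF) !imsetU1.
  by rewrite -ue.
have : #|F' :&: N| <= #|F :&: N| by apply: maxF; rewrite /P mF'.
rewrite leqNgt => /negP[]; apply: proper_card; apply/properP; split.
  apply/subsetP=> f /setIP[fF fN]; rewrite !inE fF fN andbT.
  by apply/orP; right; rewrite andbT; apply: contra eN => /eqP <-.
exists (u, v); first by rewrite !inE uvN eqxx.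
rewrite inE negb_and; apply/orP; left; apply: contra vF => h.
by apply/imsetP; exists (u, v).
Qed.

End Transversal.

Definition transversal_matroid (U V : finType) (E : {set U * V}) : matroid U :=
  Matroid (transversal_neq0 E) (@transversal_sub U V E) (@transversal_aug U V E).

Definition fold_indep (U : finType) (M : matroid U) (l : nat) : {set {set U}} :=
  [set I : {set U} | [exists Is : {ffun 'I_l -> {set U}},
    [&& [forall i, Is i \in indep M], pairwise_disjoint Is &
        \bigcup_i Is i == I]]].

Section Fold.
Variables (U : finType) (M : matroid U) (l : nat).
Implicit Types (I J : {set U}) (Is Js : {ffun 'I_l -> {set U}}).

Lemma pairwise_disjointP m (Xs : 'I_m -> {set U}) :
  reflect (forall i j x, x \in Xs i -> x \in Xs j -> i = j)
          (pairwise_disjoint Xs).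
Proof.
apply: (iffP idP) => [/forallP H i j x xi xj|H].
  apply/eqP/negPn/negP => nij.
  move/forallP/(_ j)/implyP/(_ nij): (H i) => /pred0P/(_ x) /=.
  by rewrite xi xj.
apply/forallP=> i; apply/forallP=> j; apply/implyP=> nij.
apply/pred0P=> x /=; apply/negP=> /andP[xi xj].
by case/eqP: nij; apply: H xi xj.
Qed.

Lemma fold_indepP I :
  reflect (exists Is, [/\ forall i, Is i \in indep M, pairwise_disjoint Is &
                          \bigcup_i Is i = I])
          (I \in fold_indep M l).
Proof.
rewrite inE; apply: (iffP existsP) => -[Is].
  by case/and3P=> /forallP h1 h2 /eqP h3; exists Is.
by case=> h1 h2 h3; exists Is; rewrite h2 h3 eqxx andbT andbT; apply/forallP.
Qed.

Lemma indep_set0 : set0 \in indep M.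
Proof.
by have /set0Pn[I hI] := indep_neq0 M; apply: indep_sub hI (sub0set _).
Qed.

Lemma fold_neq0 : fold_indep M l != set0.
Proof.
apply/set0Pn; exists set0; apply/fold_indepP; exists [ffun => set0]; split.
- by move=> i; rewrite ffunE indep_set0.
- by apply/pairwise_disjointP=> i j x; rewrite ffunE inE.
- by apply: big1 => i _; rewrite ffunE.
Qed.

Lemma fold_sub I J :
  J \in fold_indep M l -> I \subset J -> I \in fold_indep M l.
Proof.
case/fold_indepP=> Js [iJ /pairwise_disjointP dJ UJ] sIJ.
apply/fold_indepP; exists [ffun i => Js i :&: I]; split.
- by move=> i; rewrite ffunE; apply: indep_sub (iJ i) (subsetIl _ _).
- apply/pairwise_disjointP=> i j x; rewrite !ffunE => /setIP[xi _] /setIP[xj _].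
  exact: dJ xi xj.
- apply/setP=> x; apply/bigcupP/idP => [[i _]|xI].
    by rewrite ffunE => /setIP[].
  have : x \in \bigcup_i Js i by rewrite UJ (subsetP sIJ).
  by case/bigcupP=> i _ xi; exists i; rewrite // ffunE inE xi.
Qed.

Lemma card_fold Is :
  pairwise_disjoint Is -> #|\bigcup_i Is i| = \sum_i #|Is i|.
Proof.
move/pairwise_disjointP=> dI.
rewrite -sum1_card (eq_bigr (fun i => \sum_(x in Is i) 1)); last first.
  by move=> i _; rewrite sum1_card.
rewrite (exchange_big_dep (mem (\bigcup_i Is i))) /=; last first.
  by move=> i x _ xi; apply/bigcupP; exists i.
apply: eq_bigr => x /bigcupP[i _ xi].
rewrite (big_pred1 i) // => j /=; apply/idP/eqP=> [xj|-> //].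
exact: dI xj xi.
Qed.

Lemma fold_aug I J :
  I \in fold_indep M l -> J \in fold_indep M l -> #|I| < #|J| ->
  exists2 u, u \in J :\: I & u |: I \in fold_indep M l.
Proof.
case/fold_indepP=> I0 [iI0 dI0 UI0] /fold_indepP[Js [iJ dJ UJ]].
pose P Is := [&& [forall i, Is i \in indep M], pairwise_disjoint Is &
                 \bigcup_i Is i == I].
have PI0 : P I0 by rewrite /P dI0 UI0 eqxx !andbT; apply/forallP.
case: (arg_maxnP (fun Is => \sum_i #|Is i :&: Js i|) PI0) => Is.
case/and3P=> /forallP iI dI /eqP UI maxI.
rewrite -UI -UJ (card_fold dI) (card_fold dJ) => ltIJ.
have [i lti] : exists i, #|Is i| < #|Js i|.
  apply/existsP; apply: contraTT ltIJ; rewrite negb_exists -leqNgt => /forallP h.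
  by apply: leq_sum => i _; rewrite leqNgt.
have [x /setDP[xJ xI] ix] := indep_aug (iI i) (iJ i) lti.
have xUJ : x \in \bigcup_i Js i by apply/bigcupP; exists i.
have dI' := pairwise_disjointP _ dI.
have dJ' := pairwise_disjointP _ dJ.
pose Is' := [ffun j => if j == i then x |: Is i else Is j :\ x].
have iI' j : Is' j \in indep M.
  rewrite ffunE; case: ifP => // _; exact: indep_sub (iI j) (subD1set _ _).
have dIs' : pairwise_disjoint Is'.
  apply/pairwise_disjointP=> a b y; rewrite !ffunE.
  case: eqP => [->|_]; case: eqP => [->|_] //.
  - by move=> /setU1P[->|yi] /setD1P[/eqP nx yb] //; apply: dI' yi yb.
  - by move=> /setD1P[/eqP nx yb] /setU1P[yx|yi] //; apply: dI' yb yi.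
  - by move=> /setD1P[_ ya] /setD1P[_ yb]; apply: dI' ya yb.
have UIs' : \bigcup_j Is' j = x |: \bigcup_j Is j.
  apply/setP=> y; apply/bigcupP/setU1P => [[j _]|].
    rewrite ffunE; case: eqP => [_ /setU1P[->|yi]|_ /setD1P[_ yj]].
    - by left.
    - by right; apply/bigcupP; exists i.
    - by right; apply/bigcupP; exists j.
  have [->|nyx] := eqVneq y x.
    by exists i; rewrite // ffunE eqxx setU11.
  case=> [yx|/bigcupP[j _ yj]]; first by rewrite yx eqxx in nyx.
  exists j; rewrite // ffunE; case: eqP => [<-|_]; first by rewrite inE yj orbT.
  by rewrite !inE nyx.
have [xUI|xUI] := boolP (x \in \bigcup_j Is j); last first.
  exists x; first by rewrite inE xUI.
  by apply/fold_indepP; exists Is'.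
have : \sum_j #|Is' j :&: Js j| <= \sum_j #|Is j :&: Js j|.
  apply: maxI; rewrite /P dIs' UIs' (setUidPr _) ?sub1set // UI eqxx !andbT.
  by apply/forallP.
rewrite leqNgt => /negP[].
rewrite [ltnLHS](bigD1 i) //= [ltnRHS](bigD1 i) //= -addSn leq_add //.
  rewrite ffunE eqxx; apply: proper_card; apply/properP; split.
    by apply/setSI/subsetUr.
  by exists x; rewrite !inE ?eqxx ?xJ // (negPf xI).
apply: leq_sum => j nji; rewrite ffunE (negPf nji); apply: subset_leq_card.
apply/subsetP=> y /setIP[yI yJ]; rewrite !inE yI yJ !andbT.
by apply: contra nji => /eqP yx; rewrite yx in yJ; apply/eqP; apply: dJ' yJ xJ.
Qed.

End Fold.

Definition fold_matroid (U : finType) (M : matroid U) (l : nat) : matroid U :=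
  Matroid (fold_neq0 M l) (@fold_sub U M l) (@fold_aug U M l).

(* The domain of phi is the subtype of elements of B :\: X rather than U, so
   that phi exists also when B is contained in X and 'I_m is empty. *)
Definition robust_for (U : finType) (M : matroid U) (w : U -> nat) (k : nat)
    (X B : {set U}) : Prop :=
  let m := #|B :\: X| in
  exists (Xs : 'I_m -> {set U}) (phi : {u : U | u \in B :\: X} -> 'I_m),
    [/\ (forall i, Xs i \subset X :\: B) /\ pairwise_disjoint Xs,
        bijective phi,
        forall i, #|Xs i| = k,
        forall (u : {u : U | u \in B :\: X}) (v : U),
          v \in Xs (phi u) -> w (val u) <= w v
      & forall us : 'I_m -> U, (forall i, us i \in Xs i) ->
          (B :&: X) :|: [set us i | i : 'I_m] \in indep M].

Definition robust (U : finType) (M : matroid U) (w : U -> nat) (k : nat)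
    (X : {set U}) : Prop :=
  forall B : {set U}, base M B -> robust_for M w k X B.

Definition tau_pred (U : finType) (M : matroid U) (w : U -> nat) (k l : nat) :
    bool :=
  (0 < l) &&
  `[< forall X : {set U}, optimal_base (fold_matroid M l) w X ->
        robust M w k X >].

Lemma tau_pred_ex (U : finType) (M : matroid U) (w : U -> nat) (k : nat) :
  exists l, tau_pred M w k l.
Proof.
exists #|U|.+1; apply/andP; split=> //; apply/asboolP.
move=> X /andP[/andP[iX /forall_inP maxX] _] B /andP[iB _].
have BX : B \subset X.
  apply/subsetP=> b bB; apply: contraT => bX.
  suff /maxX : b |: X \in fold_indep M #|U|.+1.
    by rewrite cardsU1 bX ltnn.
  have {iX} /fold_indepP[Is [iI _ UI]] := iX.
  pose r (x : U) : 'I_#|U|.+1 := widen_ord (leqnSn _) (enum_rank x).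
  have r_inj : injective r.
    by move=> x y /(congr1 val) /= /ord_inj /enum_rank_inj.
  apply/fold_indepP; exists [ffun i => [set x in b |: X | r x == i]]; split.
  - move=> i; rewrite ffunE.
    have [->|[x]] := set_0Vmem [set x in b |: X | r x == i].
      exact: indep_set0.
    rewrite inE => /andP[xbX /eqP rx].
    have -> : [set x in b |: X | r x == i] = [set x].
      apply/setP=> y; rewrite inE in_set1 -rx (inj_eq r_inj).
      by case: eqP => [->|]; rewrite ?xbX ?andbF.
    case/setU1P: xbX => [->|]; first by apply: indep_sub iB _; rewrite sub1set.
    rewrite -UI => /bigcupP[j _ xj].
    by apply: indep_sub (iI j) _; rewrite sub1set.
  - apply/pairwise_disjointP=> i j x; rewrite !ffunE !inE.
    by move=> /andP[_ /eqP <-] /andP[_ /eqP <-].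
  - apply/setP=> x; apply/bigcupP/idP=> [[i _]|xbX].
      by rewrite ffunE inE => /andP[].
    by exists (r x); rewrite // ffunE inE xbX eqxx.
have BX0 : B :\: X = set0 by apply/eqP; rewrite setD_eq0.
have m0 (T : Type) : 'I_#|B :\: X| -> T.
  by rewrite BX0 cards0; case.
have u0 (T : Type) : {u : U | u \in B :\: X} -> T.
  by case=> u h; exfalso; move: h; rewrite BX0 inE.
exists (fun=> set0), (u0 _); split.
- split; first by move=> i; apply: m0 i.
  by apply/forallP=> i; apply: m0 i.
- by exists (m0 _) => x; [apply: u0 x|apply: m0 x].
- by move=> i; apply: m0 i.
- by move=> u; apply: u0 u.
- move=> us _; apply: indep_sub iB _; rewrite subUset subsetIl /=.
  by apply/subsetP=> x /imsetP[i]; apply: m0 i.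
Qed.

Definition tau (U : finType) (M : matroid U) (w : U -> nat) (k : nat) : nat :=
  ex_minn (tau_pred_ex M w k).

(* Main.v *)
Require Import Defs.
From mathcomp Require Import all_boot.
From mathcomp Require Import perm boolp.

Set Implicit Arguments.
Unset Strict Implicit.
Unset Printing Implicit Defensive.

(** An independent set of the transversal matroid is a set that can be sent
    injectively to [V] along edges, and an independent set of its [k]-fold union
    is a set that can be sent to [V] along edges so that no vertex of [V]
    receives more than [k] elements.

    Let [X] be an optimal base of the [k]-fold union, sent to [V] by such a map
    [N], and let [B] be a base, sent injectively to [V] by [p].  Start at some
    [u] in [B :\: X] and walk: from a vertex [v] of [V], beginning at [p u], go
    to [p x] for some [x] in [B :&: X] with [N x = v], as long as there is one.
    As [p] is injective, a vertex has at most one predecessor and [p u] has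
    none; hence the walk does not cycle, and walks from different elements of
    [B :\: X] are disjoint.  Let [s u] be the last vertex of the walk, and let
    [X_u] be the fibre of [N] over [s u], which does not meet [B].

    - Pushing [u] into [p u] and every [x] of the walk from [N x] on to [p x]
      places [u |: X] in such a way that only [s u] receives one element too
      many.  Maximality of [X] thus forces [s u] to hold exactly [k] elements
      of [X], and optimality forces each of them to weigh at least [w u], for it
      could be evicted in favour of [u].
    - Pulling every [x] of the walks back from [p x] to [N x] frees all the
      vertices [s u] at once; so [B :&: X] together with one element of each
      [X_u] can be sent injectively to [V].

    The walks are never written down.  Instead [p] is improved one step at a
    time: as long as some [x] in [B :&: X] has [N x = s u], the values of [s] at
    [u] and [x] are exchanged, which is one more step of the walk of [u]
    ([routing_step]); [reroute] is the result.  The two items above are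
    [overfull_exchange] and the end of [optimal_base_robust_for]. *)

(** * Independent sets as maps into the other colour class *)

Definition follows (U V : finType) (E : {set U * V}) (I : {set U})
    (f : U -> V) : Prop :=
  {in I, forall x, (x, f x) \in E}.

(** The form as a sum of booleans makes it additive when the set or the map
    changes at one element. *)
Definition load (U V : finType) (f : U -> V) (I : {set U}) (v : V) : nat :=
  \sum_(x in I) (f x == v).

Section Load.
Variables (U V : finType).
Implicit Types (f g : U -> V) (I : {set U}).

Lemma card_fibre f I v : #|[set x in I | f x == v]| = load f I v.
Proof.
rewrite -sum1_card (eq_bigl (fun x => (x \in I) && (f x == v))); last first.
  by move=> x; rewrite inE.
by rewrite big_mkcondr; apply: eq_bigr => x _; case: (f x == v).
Qed.

Lemma loadD1 f I v x : x \in I -> load f I v = (f x == v) + load f (I :\ x) v.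
Proof. by move=> xI; rewrite /load (big_setD1 x). Qed.

Lemma loadU1 f I v x : x \notin I ->
  load f (x |: I) v = (f x == v) + load f I v.
Proof. by move=> xI; rewrite /load big_setU1. Qed.

Lemma eq_load f g I v : {in I, f =1 g} -> load f I v = load g I v.
Proof. by move=> fg; apply: eq_bigr => x /fg ->. Qed.

End Load.

Section Representations.
Variables (U V : finType) (E : {set U * V}).
Implicit Types (I : {set U}) (f : U -> V).

Lemma transversal_indep_map I f :
  follows E I f -> {in I &, injective f} -> I \in transversal_indep E.
Proof.
move=> fE f_inj; apply/transversal_indepP.
exists [set (x, f x) | x in I]; last first.
  by rewrite /coveredU -imset_comp (eq_imset (g := id)) ?imset_id.
apply/matchingP; split.
- by apply/subsetP=> _ /imsetP[x xI ->]; apply: fE.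
- by move=> _ _ /imsetP[x xI ->] /imsetP[y yI ->] /= ->.
- by move=> _ _ /imsetP[x xI ->] /imsetP[y yI ->] /= /f_inj ->.
Qed.

(** The vertex [v0] serves as the value outside [I]; without it there may be no
    map from [U] to [V] at all. *)
Lemma map_of_transversal_indep (v0 : V) I : I \in transversal_indep E ->
  exists2 f : U -> V, follows E I f & {in I &, injective f}.
Proof.
case/transversal_indepP=> F /matchingP[sFE _ F_inj] ->.
pose f x := odflt v0 [pick v | (x, v) \in F].
have fF x : x \in coveredU F -> (x, f x) \in F.
  case/imsetP=> -[y v] yvF /= ->; rewrite /f.
  by case: pickP => [//|/(_ v)]; rewrite yvF.
exists f => [x /fF|x y xF yF fxy]; first exact: subsetP.
by have [] := F_inj _ _ (fF _ xF) (fF _ yF) fxy.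
Qed.

Lemma fold_indep_map (k : nat) I f :
  follows E I f -> (forall v, load f I v <= k) ->
  I \in fold_indep (transversal_matroid E) k.
Proof.
move=> fE fk; pose A v := [set x in I | f x == v].
have AP x : x \in I -> x \in A (f x) by move=> xI; rewrite inE xI eqxx.
(* The elements of a fibre are distributed over different colours. *)
pose c x := index x (enum (A (f x))).
have c_lt x : x \in I -> c x < k.
  move=> xI; apply: leq_trans (fk (f x)).
  by rewrite -card_fibre cardE index_mem mem_enum AP.
apply/fold_indepP; exists [ffun i : 'I_k => [set x in I | c x == i]]; split.
- move=> i; rewrite ffunE; apply: (transversal_indep_map (f := f)).
    by move=> x; rewrite inE => /andP[/fE].
  move=> x y; rewrite !inE => /andP[xI /eqP cx] /andP[yI /eqP cy] fxy.
  have xA : x \in enum (A (f x)) by rewrite mem_enum AP.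
  have yA : y \in enum (A (f x)) by rewrite mem_enum fxy AP.
  by rewrite -(nth_index x xA) -(nth_index x yA) -/(c x) cx fxy -/(c y) cy.
- apply/pairwise_disjointP=> i j x; rewrite !ffunE !inE.
  by move=> /andP[_ /eqP ci] /andP[_ /eqP cj]; apply/val_inj; rewrite /= -ci.
- apply/setP=> x; apply/bigcupP/idP=> [[i _]|xI].
    by rewrite ffunE inE => /andP[].
  by exists (Ordinal (c_lt x xI)); rewrite // ffunE inE xI eqxx.
Qed.

Lemma map_of_fold_indep (v0 : V) (k : nat) I :
  I \in fold_indep (transversal_matroid E) k ->
  exists2 f : U -> V, follows E I f & forall v, load f I v <= k.
Proof.
case/fold_indepP=> Is [Is_indep disjIs UIs].
have /fin_all_exists2[F FE F_inj] i := map_of_transversal_indep v0 (Is_indep i).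
pose f x := if [pick i | x \in Is i] is Some i then F i x else v0.
have fE i x : x \in Is i -> f x = F i x.
  rewrite /f => xi; case: pickP => [j xj|/(_ i)]; last by rewrite xi.
  by rewrite (pairwise_disjointP _ disjIs _ _ _ xi xj).
exists f => [x|v].
  by rewrite -UIs => /bigcupP[i _ xi]; rewrite (fE _ _ xi); apply: FE.
pose Js := [ffun i => [set x in Is i | f x == v]].
have JsE i x : (x \in Js i) = (x \in Is i) && (f x == v) by rewrite ffunE inE.
have disjJs : pairwise_disjoint Js.
  apply/pairwise_disjointP=> i j x; rewrite !JsE => /andP[xi _] /andP[xj _].
  exact: (pairwise_disjointP _ disjIs _ _ _ xi xj).
have UJs : [set x in I | f x == v] = \bigcup_i Js i.
  apply/setP=> x; rewrite inE -UIs; apply/andP/bigcupP.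
    by case=> /bigcupP[i _ xi] fx; exists i; rewrite // JsE xi.
  by case=> i _; rewrite JsE => /andP[xi fx]; split=> //; apply/bigcupP; exists i.
rewrite -card_fibre UJs (card_fold disjJs).
rewrite -[leqRHS]card_ord -sum1_card; apply: leq_sum => i _.
apply/card_le1_eqP => x y; rewrite !JsE => /andP[xi /eqP fx] /andP[yi /eqP fy].
by apply: (F_inj i) => //; rewrite -!fE // fx fy.
Qed.

End Representations.

(** * Rerouting *)

Section Reroute.
Variables (U V : finType) (E : {set U * V}) (X B : {set U}) (N : U -> V).

(** The outcome of pushing [u] along a walk that ends at [v].  Many elements may
    have moved, but independence in the fold depends on the loads only, and these
    change at [v] alone. *)
Definition overfull_at (u : U) (v : V) (g : U -> V) : Prop :=
  follows E (u |: X) g /\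
  forall z, load g (u |: X) z = load N X z + (z == v).

(** The state in the course of the walks: [s u] is the vertex now reached from
    [u], and the elements of [B :&: X] that the walks have used are among those
    at which [s] and [N] agree.  The last clause says that only these have been
    moved by [g]; it guarantees that the next element of the walk is still where
    [N] put it. *)
Definition routing (s : U -> V) : Prop :=
  [/\ {in B &, injective s}, follows E (B :&: X) s
    & {in B :\: X, forall u, exists2 g, overfull_at u (s u) g
        & {in X, forall y, g y != N y -> y \in B /\ s y = N y}}].

Lemma routing0 p : follows E X N -> follows E B p -> {in B &, injective p} ->
  routing p.
Proof.
move=> NE pE p_inj; split=> // [x /setIP[xB _]|u /setDP[uB uX]]; first exact: pE.
have eqN : {in X, (fun z => if z == u then p u else N z) =1 N}.
  by move=> y yX; case: eqP => // yu; rewrite -yu yX in uX.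
exists (fun z => if z == u then p u else N z); last first.
  by move=> y /eqN ->; rewrite eqxx.
split=> [x|z]; last first.
  by rewrite loadU1 // eqxx (eq_load _ eqN) addnC eq_sym.
by case/setU1P=> [->|xX]; [rewrite eqxx; apply: pE|rewrite eqN //; apply: NE].
Qed.

(** If [N] puts an element [x] of [B] at [s u], the walk of [u] goes on through
    [x] to [s x], and in return [s] sends [x] to [N x]. *)
Lemma routing_step s u x : routing s -> u \in B :\: X -> x \in B :&: X ->
  N x = s u -> routing (s \o tperm u x).
Proof.
move=> [s_inj sE sg] /[dup] uBX /setDP[uB uX] /[dup] xBX /setIP[xB xX] Nx.
have nxu : x != u by apply: contraNneq uX => <-.
have tX y : y \in X -> y != x -> tperm u x y = y.
  by move=> yX nyx; rewrite tpermD 1?eq_sym //; apply: contraNneq uX => <-.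
have tB y : y \in B -> tperm u x y \in B by case: tpermP => // ->.
have unmoved g : {in X, forall y, g y != N y -> y \in B /\ s y = N y} ->
    g x = N x.
  move=> gN; apply/eqP/negPn/negP => /(gN x xX)[_ sx].
  by case/eqP: nxu; apply: s_inj; rewrite // sx.
have keep y : s y = N y -> y \in X -> s (tperm u x y) = N y.
  have [->|nyx] := eqVneq y x; first by rewrite tpermR Nx.
  by move=> sy yX; rewrite tX.
split=> [a b aB bB /= /s_inj|y /setIP[yB yX] /=|u' /[dup] u'BX /setDP[u'B u'X]].
- by move/(_ (tB _ aB) (tB _ bB)); apply: perm_inj.
- have [->|nyx] := eqVneq y x; last by rewrite tX //; apply: sE; rewrite inE yB.
  rewrite tpermR -Nx; have [g [gE _] /unmoved <-] := sg u uBX.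
  by apply: gE; rewrite setU1r.
have [g [gE gl] gN] := sg u' u'BX.
have [u'u|nu'u] := eqVneq u' u; last first.
  have -> : (s \o tperm u x) u' = s u'.
    by rewrite /= tpermD // 1?eq_sym //; apply: contraNneq u'X => ->.
  by exists g => // y yX /(gN y yX)[yB /keep/(_ yX)].
move: gE gl gN; rewrite {}u'u /= tpermL => gE gl gN.
have gx := unmoved g gN.
pose g' z := if z == x then s x else g z.
have g'E : {in (u |: X) :\ x, g' =1 g}.
  by move=> z /setD1P[nzx _]; rewrite /g' (negPf nzx).
have xuX : x \in u |: X by rewrite setU1r.
exists g'; first split.
- move=> z zuX; rewrite /g'; case: eqP => [->|_]; [exact: sE|exact: gE].
- move=> z; apply/eqP; rewrite -(eqn_add2r (z == s u)) addnAC -gl.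
  rewrite !(loadD1 _ _ xuX) (eq_load _ g'E) gx Nx /g' eqxx.
  by rewrite ![z == _]eq_sym addnC -[eqbRHS]addnA (addnC (s x == z)).
- move=> y yX; rewrite /g'; case: (y =P x) => [->|_]; last first.
    by move=> /(gN y yX)[yB /keep/(_ yX)].
  by rewrite tpermR Nx.
Qed.

(** Each step makes [s] and [N] agree at one more element of [B :&: X], so that
    all walks end, at vertices whose fibres under [N] do not meet [B]. *)
Lemma reroute p : routing p ->
  exists2 s, routing s & {in B :\: X & B :&: X, forall u x, N x != s u}.
Proof.
have [n] := ubnP #|[set x in B :&: X | p x != N x]|.
elim: n p => // n IHn p ltn rp.
have [/exists_inP[u uBX /exists_inP[x xBX /eqP Nx]]|ends] :=
  boolP [exists u in B :\: X, exists x in B :&: X, N x == p u]; last first.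
  exists p => // u x uBX xBX; apply: contra ends => Nx.
  by apply/exists_inP; exists u => //; apply/exists_inP; exists x.
apply: (IHn (p \o tperm u x)); last exact: routing_step.
rewrite ltnS in ltn; apply: leq_trans ltn; apply: proper_card.
have [p_inj _ _] := rp; have [uB uX] := setDP uBX; have [xB xX] := setIP xBX.
have nxu : x != u by apply: contraNneq uX => <-.
apply/properP; split.
  apply/subsetP=> y; rewrite !inE /= => /andP[/andP[yB yX]].
  have nyu : y != u by apply: contraNneq uX => <-.
  have [->|nyx] := eqVneq y x; first by rewrite tpermR Nx eqxx.
  by rewrite tpermD 1?eq_sym // yB yX.
exists x; last by rewrite inE /= tpermR Nx eqxx andbF.
by rewrite inE xBX Nx; apply: contra nxu => /eqP/p_inj ->.
Qed.

End Reroute.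

(** * Robustness of optimal bases *)

(** Sets indexed by [B :\: X] itself, rather than by their numbers. *)
Lemma robust_forI (U : finType) (M : matroid U) (w : U -> nat) (k : nat)
    (X B : {set U}) (Y : U -> {set U}) :
  {in B :\: X, forall u, Y u \subset X :\: B} ->
  {in B :\: X &, forall u u' x, x \in Y u -> x \in Y u' -> u = u'} ->
  {in B :\: X, forall u, #|Y u| = k} ->
  {in B :\: X, forall u v, v \in Y u -> w u <= w v} ->
  (forall g : U -> U, {in B :\: X, forall u, g u \in Y u} ->
     (B :&: X) :|: g @: (B :\: X) \in indep M) ->
  robust_for M w k X B.
Proof.
move=> YX Ydisj Yk Yw Yindep.
pose A := B :\: X; pose e (i : 'I_#|A|) : U := enum_val i.
have eA i : e i \in A by apply: enum_valP.
have e_inj : injective e by apply: (@enum_val_inj _ (mem A)).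
pose phi (u : {u | u \in A}) : 'I_#|A| := enum_rank_in (valP u) (val u).
have phiK u : e (phi u) = val u by apply: enum_rankK_in (valP u).
exists (fun i => Y (e i)), phi; split.
- split=> [i|]; first exact: YX.
  by apply/pairwise_disjointP=> i j x xi xj; apply: e_inj; apply: Ydisj xi xj.
- exists (fun i => exist _ (e i) (eA i)) => [u|i].
    by apply: val_inj; rewrite /= phiK.
  by apply: e_inj; rewrite phiK.
- by move=> i; apply: Yk.
- by move=> u v; rewrite phiK; apply: Yw (valP u) _.
- move=> us usY.
  pose g u := if [pick i | e i == u] is Some i then us i else u.
  have gE i : g (e i) = us i.
    rewrite /g; case: pickP => [j /eqP/e_inj -> //|/(_ i)].
    by rewrite eqxx.
  have gY : {in A, forall u, g u \in Y u}.
    by move=> u uA; have /= <- := phiK (exist _ u uA); rewrite gE.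
  apply: indep_sub (Yindep g gY) _; apply: setUS.
  by apply/subsetP=> _ /imsetP[i _ ->]; rewrite -gE imset_f.
Qed.

Section OptimalBase.
Variables (U V : finType) (E : {set U * V}) (w : U -> nat) (k : nat).
Variables (X : {set U}) (N : U -> V).
Hypothesis X_opt : optimal_base (fold_matroid (transversal_matroid E) k) w X.
Hypothesis N_load : forall v, load N X v <= k.

(** If [v] had room, [u |: X] would be independent, against the maximality of
    [X].  If an element [y] that [g] puts at [v] is removed, all loads are those
    of [N] again, so that [(u |: X) :\ y] is another base. *)
Lemma overfull_exchange u v g : u \notin X -> overfull_at E X N u v g ->
  load N X v = k /\ {in X, forall y, g y = v -> w u <= w y}.
Proof.
move=> uX [gE gl]; have /andP[/andP[_ /forall_inP Xmax] /forallP Xopt] := X_opt.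
split.
  apply/eqP; rewrite eqn_leq N_load leqNgt; apply/negP => ltk.
  suff /Xmax : u |: X \in fold_indep (transversal_matroid E) k.
    by rewrite cardsU1 uX ltnn.
  apply: fold_indep_map gE _ => z; rewrite gl.
  by case: eqP => [->|_]; rewrite ?addn1 ?addn0.
move=> y yX gy; have yuX : y \in u |: X by rewrite setU1r.
pose X' := (u |: X) :\ y.
have X'indep : X' \in fold_indep (transversal_matroid E) k.
  apply: (fold_indep_map (f := g)) => [x /setD1P[_ /gE] //|z].
  have := gl z; rewrite (loadD1 _ _ yuX) gy eq_sym addnC => /eqP.
  by rewrite eqn_add2r => /eqP ->.
have cardX' : #|X'| = #|X|.
  have := cardsD1 y (u |: X); rewrite yuX cardsU1 uX => /eqP.
  by rewrite eqn_add2l => /eqP.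
have X'base : base (fold_matroid (transversal_matroid E) k) X'.
  apply/andP; split=> //; apply/forall_inP=> I /Xmax.
  by rewrite cardX'.
have := Xopt X'; rewrite X'base /= /weight.
rewrite -(leq_add2l (w y)) -big_setD1 // big_setU1 //=.
by rewrite leq_add2r.
Qed.

Lemma optimal_base_robust_for (B : {set U}) (p : U -> V) :
  follows E X N -> follows E B p -> {in B &, injective p} ->
  robust_for (transversal_matroid E) w k X B.
Proof.
move=> NE pE p_inj.
have [s [s_inj sE sg] s_free] := reroute (routing0 NE pE p_inj).
pose Y u := [set x in X | N x == s u].
have YX u x : u \in B :\: X -> x \in Y u -> x \in X :\: B /\ N x = s u.
  rewrite !inE => uBX /andP[xX /eqP Nx]; rewrite xX andbT; split=> //.
  apply/negP => xB; have := s_free u x; rewrite inE uBX inE xB xX Nx eqxx.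
  by move=> /(_ isT isT).
have YB u : u \in B :\: X -> u \in B by case/setDP.
apply: (robust_forI (Y := Y)).
- by move=> u uBX; apply/subsetP=> x /(YX u x uBX)[].
- move=> u u' uBX u'BX x /(YX u x uBX)[_ Nx] /(YX u' x u'BX)[_].
  by rewrite Nx; apply: s_inj; apply: YB.
- move=> u uBX; have [uB uX] := setDP uBX; have [g g_over _] := sg u uBX.
  by rewrite card_fibre; have [] := overfull_exchange uX g_over.
- move=> u uBX x xY; have [/setDP[xX xB] Nx] := YX u x uBX xY.
  have [uB uX] := setDP uBX; have [g g_over gN] := sg u uBX.
  have [_] := overfull_exchange uX g_over; apply=> //.
  (* An element outside [B] has not been moved. *)
  rewrite -Nx; apply/eqP/negPn/negP => /(gN x xX)[xB' _].
  by rewrite xB' in xB.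
(* On [B :&: X] the walks are pulled back by [s], which leaves the vertices [s u]
   to the chosen elements, since [N (g u) = s u]. *)
move=> g gY; pose h x := if x \in B then s x else N x.
have hg u : u \in B :\: X -> h (g u) = s u.
  move=> uBX; have [/setDP[_ /negPf guB] Ngu] := YX u _ uBX (gY u uBX).
  by rewrite /h guB.
have hB x : x \in B :&: X -> h x = s x by case/setIP=> xB _; rewrite /h xB.
have BB x : x \in B :&: X -> x \in B by case/setIP.
apply: (transversal_indep_map (f := h)).
  move=> x /setUP[xBX|/imsetP[u uBX ->]]; first by rewrite hB //; apply: sE.
  have [/setDP[guX _] Ngu] := YX u _ uBX (gY u uBX).
  by rewrite hg // -Ngu; apply: NE.
have disj x u : x \in B :&: X -> u \in B :\: X -> s x <> s u.
  move=> /[dup] /BB xB /setIP[_ xX] /[dup] /YB uB /setDP[_ uX] /s_inj xu.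
  by rewrite -xu ?xX in uX.
move=> x y /setUP[xBX|/imsetP[u uBX ->]] /setUP[yBX|/imsetP[u' u'BX ->]].
- by rewrite !hB //; apply: s_inj; apply: BB.
- by rewrite hB // hg // => /disj; case.
- by rewrite hg // hB // => /esym/disj; case.
- by rewrite !hg // => /s_inj ->; rewrite ?YB.
Qed.

End OptimalBase.

Lemma optimal_base_robust (U V : finType) (E : {set U * V}) (w : U -> nat)
    (k : nat) (X : {set U}) :
  optimal_base (fold_matroid (transversal_matroid E) k) w X ->
  robust (transversal_matroid E) w k X.
Proof.
move=> X_opt B /andP[B_indep _].
have [v0 _|V0] := pickP V; last first.
  (* Without vertices in [V] the only base is the empty set. *)
  have B0 : B = set0.
    have /transversal_indepP[F _ ->] := B_indep.
    by apply/setP=> x; rewrite inE; apply/imsetP => -[[u v] _ _]; have := V0 v.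
  have noBX u : u \notin B :\: X by rewrite B0 set0D inE.
  apply: (robust_forI (Y := fun=> set0)) => [u|u u'|u|u|g _];
    rewrite ?(negPf (noBX u)) //.
  by rewrite B0 set0I set0D imset0 setU0; apply: indep_set0.
have /andP[/andP[X_indep _] _] := X_opt.
have [N NE N_load] := map_of_fold_indep v0 X_indep.
have [p pE p_inj] := map_of_transversal_indep v0 B_indep.
exact: optimal_base_robust_for NE pE p_inj.
Qed.

Theorem theorem1 (U V : finType) (E : {set U * V}) (w : U -> nat) (k : nat)
  (hk : 0 < k) :
  tau (transversal_matroid E) w k <= k.
Proof.
rewrite /tau; case: ex_minnP => l _; apply; rewrite /tau_pred hk /=.
apply/asboolP => X; exact: optimal_base_robust.
Qed.
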